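(* Let $\mathcal C$ be a $P$-polynomial coherent configuration, with the relations of every block numbered according to orderings that witness the $P$-polynomial property. Fix distinct $i,j\in\Omega$ such that $\widetilde r_{i,j}\ge1$. Then the following are equivalent: (i) There exist constants $\alpha_{i,j},\beta_{i,j}\in\mathbb R$, with $\alpha_{i,j}\ne0$, such that for every $0\le h\le\widetilde r_{i,j}$, $$\overline{P_1^{(i,i)}}(h)=\alpha_{i,j}\,\overline{P_2^{(i,j)}}(h)+\beta_{i,j}.$$ (ii) The cross-block intersection matrix $B_1^{(i,i,j)}=\bigl(p^{(i,i,j)}_{1,\ell,\ell'}\bigr)_{\varepsilon_{i,j}\le\ell,\ell'\le r_{i,j}}$ is tridiagonal. Moreover, if these conditions hold, then $\alpha_{i,j}=p^{(i,i,j)}_{1,1,2}$ and $\beta_{i,j}=p^{(i,i,j)}_{1,1,1}$.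
   Context: **Coherent configurations.** A coherent configuration is a pair $\mathcal C=(X,\mathcal R)$, where $X$ is a nonempty finite set and $\mathcal R=\{R_i\mid i\in I\}$ is a partition of $X\times X$ into nonempty sets such that: if $R_i$ meets $\operatorname{diag}(X\times X)=\{(x,x)\mid x\in X\}$ then $R_i\subseteq\operatorname{diag}(X\times X)$; the transpose of each $R_i$ is in $\mathcal R$; and for all $i,j,h\in I$ the number $|\{z\in X\mid (x,z)\in R_i,(z,y)\in R_j\}|$ does not depend on the choice of $(x,y)\in R_h$. Let $\Omega\subseteq I$ be such that $\operatorname{diag}(X\times X)=\bigsqcup_{i\in\Omega}R_i$. For $i\in\Omega$ the fiber $X_i$ is the set of $x$ with $(x,x)\in R_i$; the fibers partition $X$, and each relation is contained in a single $X_i\times X_j$. Put $\varepsilon_{i,j}=1-\delta_{i,j}$, $I^{(i,j)}=\{\ell\in I\mid R_\ell\subseteq X_i\times X_j\}$, $r_{i,j}=|I^{(i,j)}|-\delta_{i,j}$, $\widetilde r_{i,j}=r_{i,j}-\varepsilon_{i,j}$. The relations in $X_i\times X_j$ are numbered $R^{(i,j)}_\ell$, $\varepsilon_{i,j}\le\ell\le r_{i,j}$, with $R_0^{(i,i)}=\operatorname{diag}(X_i\times X_i)$ and with $R^{(j,i)}_\ell$ the transpose of $R^{(i,j)}_\ell$. Let $A^{(i,j)}_\ell$ be the adjacency matrix of $R^{(i,j)}_\ell$ (indexed by $X\times X$, or equivalently, as a block, by $X_i\times X_j$), and $\mathcal A^{(i,j)}=\operatorname{span}_{\mathbb C}\{A_\ell^{(i,j)}\}$.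 The intersection numbers $p^{(i,j,h)}_{\ell,m,n}$ are defined by $A_\ell^{(i,j)}A_m^{(j,h)}=\sum_{n=\varepsilon_{i,h}}^{r_{i,h}}p^{(i,j,h)}_{\ell,m,n}A_n^{(i,h)}$. **Standing assumptions.** Each fiber carries a symmetric association scheme (all $R^{(i,i)}_\ell$ symmetric), and there are matrices $E_h^{(i,j)}$ ($i,j\in\Omega$, $0\le h\le\widetilde r_{i,j}$) such that: (B1) $E_0^{(i,j)}=\frac1{\sqrt{|X_i||X_j|}}J$ on the block $X_i\times X_j$ ($J$ all-ones); (B2) $\{E_h^{(i,j)}\}_{h}$ is a basis of $\mathcal A^{(i,j)}$; (B3) the transpose of $E_\ell^{(i,j)}$ is $E_\ell^{(j,i)}$; (B4) $E_\ell^{(i,j)}E_{\ell'}^{(i',j')}=\delta_{j,i'}\delta_{\ell,\ell'}E_\ell^{(i,j')}$. The eigenvalues $P_\ell^{(i,j)}(h)$ are defined by $A_\ell^{(i,j)}=\sum_{h=0}^{\widetilde r_{i,j}}P_\ell^{(i,j)}(h)E_h^{(i,j)}$. **$P$-polynomial.** $\mathcal C$ is $P$-polynomial if for every $i,j\in\Omega$ there is an ordering $A^{(i,j)}_{\varepsilon_{i,j}},\dots,A^{(i,j)}_{r_{i,j}}$ of the adjacency matrices of the block (with $A_0^{(i,i)}$ the identity of $X_i$) such that $P^{(i,j)}_{\varepsilon_{i,j}}(h)\ne0$ for all $0\le h\le\widetilde r_{i,j}$ and, with $\overline{P_\ell^{(i,j)}}(h)=P_\ell^{(i,j)}(h)/P_{\varepsilon_{i,j}}^{(i,j)}(h)$,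 there are polynomials $v^{(i,j)}_\ell$ ($\varepsilon_{i,j}\le\ell\le r_{i,j}$) with $\deg v_\ell^{(i,j)}=\ell-\varepsilon_{i,j}$ and $\overline{P_\ell^{(i,j)}}(h)=v_\ell^{(i,j)}\bigl(\overline{P_{1+\varepsilon_{i,j}}^{(i,j)}}(h)\bigr)$ for all $0\le h\le\widetilde r_{i,j}$. (If $\widetilde r_{i,j}=0$ the polynomial condition is trivial.) A matrix $(b_{\ell,\ell'})$ is tridiagonal if $b_{\ell,\ell'}=0$ whenever $|\ell-\ell'|>1$. *)

(* Defs.v *)
From mathcomp Require Import all_boot all_order all_algebra.
From mathcomp Require Import reals complex.

Set Implicit Arguments.
Unset Strict Implicit.
Unset Printing Implicit Defensive.

Import GRing.Theory Num.Theory.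

Local Open Scope ring_scope.
Local Open Scope complex_scope.

Definition diagrel (X : finType) : {set X * X} := [set u | u.1 == u.2].

Definition transrel (X : finType) (S : {set X * X}) : {set X * X} :=
  [set u | (u.2, u.1) \in S].

Record coherent_configuration (X I : finType) := CoherentConfiguration {
  ccrel :> I -> {set X * X};
  cc_point_gt0 : (0 < #|X|)%N;
  cc_inj : injective ccrel;
  cc_partition : partition [set ccrel i | i : I] [set: X * X];
  cc_diag : forall i : I,
    ccrel i :&: diagrel X != set0 -> ccrel i \subset diagrel X;
  cc_trans : forall i : I, exists j : I, ccrel j = transrel (ccrel i);
  cc_coherent : forall (i j h : I) (u w : X * X),
    u \in ccrel h -> w \in ccrel h ->
    #|[set z | ((u.1, z) \in ccrel i) && ((z, u.2) \in ccrel j)]| =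
    #|[set z | ((w.1, z) \in ccrel i) && ((z, w.2) \in ccrel j)]|
}.

Section Configuration.
Variables (X I : finType) (C : coherent_configuration X I).

Definition Omega : {set I} := [set i | C i \subset diagrel X].

Definition fiber (i : I) : {set X} := [set x | (x, x) \in C i].

Definition block (i j : I) : {set I} :=
  [set l | C l \subset setX (fiber i) (fiber j)].

Definition eps (i j : I) : nat := (i != j).

(* The subtractions below are exact when i, j are in Omega, because then
   block i j is nonempty. *)
Definition rnum (i j : I) : nat := (#|block i j| - (i == j))%N.
Definition rtilde (i j : I) : nat := (rnum i j - eps i j)%N.

Definition symmetric_fibers : Prop :=
  forall i, i \in Omega -> forall l, l \in block i i -> transrel (C l) = C l.

(* nu i j l is the index of the relation R^{(i,j)}_l, eps i j <= l <= r_{i,j};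
   the values of nu outside this range are irrelevant. *)
Definition block_numbering (nu : I -> I -> nat -> I) : Prop :=
  [/\ forall i j, i \in Omega -> j \in Omega ->
        perm_eq [seq nu i j l | l <- index_iota (eps i j) (rnum i j).+1]
                (enum (block i j)),
      forall i, i \in Omega ->
        C (nu i i 0) = [set u in setX (fiber i) (fiber i) | u.1 == u.2]
    & forall i j, i \in Omega -> j \in Omega ->
      forall l, (eps i j <= l <= rnum i j)%N ->
        C (nu j i l) = transrel (C (nu i j l))].

Variable R : realType.

(* Matrices indexed by X x X are square matrices of order #|X|, the points
   being enumerated by enum_val; an element of a block is a matrix on the whole
   of X that vanishes outside the block. *)
Definition relmx (S : {set X * X}) : 'M[R[i]]_#|X| :=
  \matrix_(x, y) ((enum_val x, enum_val y) \in S)%:R.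

Definition block_space (i j : I) : {vspace 'M[R[i]]_#|X|} :=
  <<[seq relmx (C l) | l <- enum (block i j)]>>%VS.

(* In the last condition, the index l on the right-hand side satisfies
   l <= rtilde i j' whenever j = i' and l = l': this follows from the four
   conditions together. *)
Definition block_bases (E : I -> I -> nat -> 'M[R[i]]_#|X|) : Prop :=
  [/\ forall i j, i \in Omega -> j \in Omega ->
        E i j 0 = ((Num.sqrt (#|fiber i|%:R * #|fiber j|%:R : R))^-1)%:C
                    *: relmx (setX (fiber i) (fiber j)),
      forall i j, i \in Omega -> j \in Omega ->
        basis_of (block_space i j) [seq E i j h | h <- iota 0 (rtilde i j).+1],
      forall i j, i \in Omega -> j \in Omega ->
        forall l, (l <= rtilde i j)%N -> (E i j l)^T = E j i l
    & forall i j i' j', i \in Omega -> j \in Omega ->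
        i' \in Omega -> j' \in Omega ->
        forall l l', (l <= rtilde i j)%N -> (l' <= rtilde i' j')%N ->
        E i j l *m E i' j' l' = ((j == i') && (l == l'))%:R *: E i j' l].

Variable nu : I -> I -> nat -> I.

Definition adjmx (i j : I) (l : nat) : 'M[R[i]]_#|X| := relmx (C (nu i j l)).

(* p i j h l m n is p^{(i,j,h)}_{l,m,n}. *)
Definition intersection_numbers
    (p : I -> I -> I -> nat -> nat -> nat -> R[i]) : Prop :=
  forall i j h, i \in Omega -> j \in Omega -> h \in Omega ->
  forall l m, (eps i j <= l <= rnum i j)%N -> (eps j h <= m <= rnum j h)%N ->
  adjmx i j l *m adjmx j h m =
    \sum_(eps i h <= n < (rnum i h).+1) p i j h l m n *: adjmx i h n.

(* P i j l h is P^{(i,j)}_l(h). *)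
Definition eigenvalues (E : I -> I -> nat -> 'M[R[i]]_#|X|)
    (P : I -> I -> nat -> nat -> R[i]) : Prop :=
  forall i j, i \in Omega -> j \in Omega ->
  forall l, (eps i j <= l <= rnum i j)%N ->
  adjmx i j l = \sum_(0 <= h < (rtilde i j).+1) P i j l h *: E i j h.

Definition Pbar (P : I -> I -> nat -> nat -> R[i]) (i j : I) (l h : nat) : R[i] :=
  P i j l h / P i j (eps i j) h.

(* The numbering with respect to which the eigenvalues P are taken witnesses
   that the configuration is P-polynomial. *)
Definition P_polynomial_witness (P : I -> I -> nat -> nat -> R[i]) : Prop :=
  forall i j, i \in Omega -> j \in Omega ->
  (forall h, (h <= rtilde i j)%N -> P i j (eps i j) h != 0) /\
  exists v : nat -> {poly R[i]},
    forall l, (eps i j <= l <= rnum i j)%N ->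
      size (v l) = (l - eps i j).+1 /\
      forall h, (h <= rtilde i j)%N ->
        Pbar P i j l h = (v l).[Pbar P i j (1 + eps i j)%N h].

(* Rows and columns are shifted by eps i j, so that they start at 0. *)
Definition cross_mx (p : I -> I -> I -> nat -> nat -> nat -> R[i])
    (i j : I) : 'M[R[i]]_((rtilde i j).+1) :=
  \matrix_(l, l') p i i j 1%N (l + eps i j)%N (l' + eps i j)%N.

End Configuration.

Definition tridiagonal (K : nzRingType) (n : nat) (M : 'M[K]_n) : Prop :=
  forall l l' : 'I_n, (l.+1 < l')%N || (l'.+1 < l)%N -> M l l' = 0.

Arguments adjmx {X I} C R nu i j l.

(* Main.v *)
Require Import Defs.
From HB Require Import structures.
From mathcomp Require Import all_boot all_order all_algebra.
From mathcomp Require Import reals complex.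

Set Implicit Arguments.
Unset Strict Implicit.
Unset Printing Implicit Defensive.

Import GRing.Theory Num.Theory.

Local Open Scope ring_scope.
Local Open Scope complex_scope.

(** Fix distinct fibers [i], [j], and write [d] for [rtilde C i j], [x h] for
    [Pbar P i i 1 h], [y h] for [Pbar P i j 2 h] and [M l n] for the entries of
    the cross-block matrix.  Comparing the coordinates on [E i j h] of the
    product of [adjmx C R nu i i 1] and [adjmx C R nu i j l.+1], expanded once
    with eigenvalues and once with intersection numbers ([eigenvalue_mul]),
    and dividing by [P i j 1 h], gives the recurrence
      [x h * Pbar P i j l.+1 h = \sum_n M l n * Pbar P i j n.+1 h],
    in which [Pbar P i j n.+1 h] is the value at [y h] of a polynomial of
    degree [n].  Dividing by [P i i 0 h] costs nothing, because it is [1]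
    ([eigenvalue0]); the eigenvalues of the fiber are available at every
    [h <= d] because [rtilde C i j <= rtilde C i i] ([rtilde_le]).

    The [d.+1] nodes [y h] are distinct ([Pbar_inj]), so an identity between
    their values is an identity between polynomials of degree at most [d].  If
    [x] is an affine function of [y], the left-hand side of the recurrence has
    degree at most [l.+1], so [M l n = 0] for [n > l.+1]
    ([graded_recurrence_upper]); since the scheme on the fiber [i] is
    symmetric, [M l n] and [M n l] vanish together
    ([intersection_number_eq0C]) and [M] is tridiagonal.

    Conversely, if [M] is tridiagonal, row [0] of the recurrence reads
    [x h = M 0 0 + M 0 1 * y h].  Intersection numbers are natural numbers,
    hence real, and [M 0 1] is nonzero because the [x h] are distinct too, the
    block [(i, i)] being [P]-polynomial.  The same row determines the two
    coefficients, as [y] takes at least two values. *)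

(** * Linear algebra and polynomials *)

Lemma linear_span_eq0 (K : fieldType) (vT wT : vectType K)
    (f : {linear vT -> wT}) (s : seq vT) :
  (forall v, v \in s -> f v = 0) -> forall v, v \in <<s>>%VS -> f v = 0.
Proof.
move=> f0 v vs; have /subvP/(_ v vs) : (<<s>> <= lker (linfun f))%VS.
  by apply/span_subvP => u us; rewrite memv_ker lfunE /= f0.
by rewrite memv_ker lfunE => /eqP.
Qed.

Section GradedFamily.
Variables (K : fieldType) (d : nat) (V : nat -> {poly K}).
Hypothesis sizeV : forall n, (n <= d)%N -> size (V n) = n.+1.

Lemma size_graded_sum (c : nat -> K) (m : nat) : (m <= d.+1)%N ->
  (size (\sum_(0 <= n < m) c n *: V n)%R <= m)%N.
Proof.
elim: m => [|m IH] md; first by rewrite big_geq // size_poly0.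
rewrite big_nat_recr //=; apply: leq_trans (size_polyD _ _) _.
rewrite geq_max (leq_trans (IH _)) //=; last exact: ltnW.
by apply: leq_trans (size_scale_leq _ _) _; rewrite sizeV.
Qed.

(** The top term of the sum cannot be cancelled, so the size of the sum
    detects the last nonzero coefficient; the induction strips vanishing terms
    off the top. *)
Lemma graded_coef_eq0 (c : nat -> K) (k m n : nat) : (m <= d.+1)%N ->
  (size (\sum_(0 <= n < m) c n *: V n)%R <= k)%N ->
  (k <= n < m)%N -> c n = 0.
Proof.
elim: m => [|m IH] md; first by rewrite andbC.
rewrite big_nat_recr //= => sz /andP[kn nm].
have cm : c m = 0.
  apply/eqP; apply: contraTT (leq_trans kn nm) => cm0.
  rewrite -ltnNge; apply: leq_trans sz.
  rewrite addrC size_polyDl size_scale ?sizeV //.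
  by rewrite ltnS size_graded_sum // ltnW.
move: nm; rewrite ltnS leq_eqVlt => /predU1P[-> //|nm].
apply: IH; first exact: ltnW.
- by move: sz; rewrite cm scale0r addr0.
- by rewrite kn nm.
Qed.

(** Both sides of the recurrence are values of polynomials of degree at most
    [d] at [d + 1] distinct nodes, so the recurrence is a polynomial identity,
    whose left-hand side has degree at most [l + 1]. *)
Lemma graded_recurrence_upper (x y : nat -> K) (a b : K)
    (M : nat -> nat -> K) :
  {in gtn d.+1 &, injective y} ->
  (forall h, (h <= d)%N -> x h = a * y h + b) ->
  (forall l h, (l <= d)%N -> (h <= d)%N ->
     x h * (V l).[y h] = \sum_(0 <= n < d.+1) M l n * (V n).[y h]) ->
  forall l n, (l.+1 < n <= d)%N -> M l n = 0.
Proof.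
move=> yinj xE rec l n /andP[ln nd].
have ld : (l.+1 < d)%N := leq_trans ln nd.
set q := (a *: 'X + b%:P) * V l.
have szq : (size q <= l.+2)%N.
  apply: leq_trans (size_polyMleq _ _) _; rewrite sizeV;
    last by do 2!apply: ltnW.
  rewrite addnS /= -[l.+2]/(2 + l)%N leq_add2r.
  apply: leq_trans (size_polyD _ _) _; rewrite geq_max size_polyC.
  by rewrite (leq_trans (size_scale_leq _ _)) ?size_polyX //; case: (b != 0).
have qE : \sum_(0 <= n < d.+1) M l n *: V n = q.
  apply/eqP; rewrite eq_sym -subr_eq0; apply/eqP.
  pose ys := [seq y h | h <- iota 0 d.+1].
  apply: (@roots_geq_poly_eq0 _ _ ys).
  - apply/allP => _ /mapP[h + ->]; rewrite mem_iota ltnS => /= hd.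
    apply/rootP; rewrite hornerD hornerN horner_sum.
    under eq_bigr do rewrite hornerZ.
    rewrite -rec //; last by do 2!apply: ltnW.
    by rewrite hornerM hornerD hornerZ hornerX hornerC xE // subrr.
  - rewrite map_inj_in_uniq ?iota_uniq // => h k.
    by rewrite !mem_iota !add0n => ? ?; apply: yinj.
  - rewrite size_map size_iota; apply: leq_trans (size_polyD _ _) _.
    rewrite size_polyN geq_max size_graded_sum // andbT.
    exact: leq_trans szq (ltnW _).
apply: (@graded_coef_eq0 (M l) l.+2 d.+1) => //; first by rewrite qE.
by rewrite ln ltnS.
Qed.

End GradedFamily.

(** * Relations and intersection numbers *)

Section Configuration.
Variables (X I : finType) (C : coherent_configuration X I).

Lemma ccrel_meet (a b : I) (u : X * X) : u \in C a -> u \in C b -> a = b.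
Proof.
move=> ua ub; apply: (@cc_inj _ _ C); apply/eqP.
have /and3P[_ /trivIsetP tI _] := cc_partition C.
apply/negPn/negP => /(tI _ _ (imset_f _ isT) (imset_f _ isT)).
by move/disjoint_setI0/setP/(_ u); rewrite !inE ua ub.
Qed.

Lemma ccrel_inhabited (a : I) : exists u, u \in C a.
Proof.
have /and3P[_ _ n0] := cc_partition C.
by apply/set0Pn; apply: contraNneq n0 => <-; apply: imset_f.
Qed.

Variables (R : realType) (nu : I -> I -> nat -> I).
Hypothesis nuP : block_numbering C nu.

Lemma nu_block (i j : I) (l : nat) : i \in Omega C -> j \in Omega C ->
  (eps i j <= l <= rnum C i j)%N -> nu i j l \in block C i j.
Proof.
move=> iO jO lr; have [/(_ i j iO jO)/perm_mem pe _ _] := nuP.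
by rewrite -mem_enum -pe; apply: map_f; rewrite mem_index_iota ltnS.
Qed.

Lemma nu_inj (i j : I) (l m : nat) : i \in Omega C -> j \in Omega C ->
  (eps i j <= l <= rnum C i j)%N -> (eps i j <= m <= rnum C i j)%N ->
  nu i j l = nu i j m -> l = m.
Proof.
move=> iO jO lr mr; have [/(_ i j iO jO)/perm_uniq pe _ _] := nuP.
move: pe; rewrite enum_uniq => un e.
set r := index_iota _ _ in un.
have [ls ms] : l \in r /\ m \in r by rewrite !mem_index_iota.
rewrite -(nth_index 0%N ls) -(nth_index 0%N ms); congr nth; apply/eqP.
rewrite -(nth_uniq (nu i j 0) _ _ un) ?size_map ?index_mem //.
by rewrite !(nth_map 0%N) ?index_mem // !nth_index // e.
Qed.

Lemma block_nu (i j a : I) : i \in Omega C -> j \in Omega C ->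
  a \in block C i j -> exists2 l, (eps i j <= l <= rnum C i j)%N & a = nu i j l.
Proof.
move=> iO jO; have [/(_ i j iO jO)/perm_mem pe _ _] := nuP.
rewrite -mem_enum -pe => /mapP[l + ->].
by rewrite mem_index_iota ltnS; exists l.
Qed.

Lemma relmx_mulE (S T : {set X * X}) (u : X * X) :
  (relmx R S *m relmx R T) (enum_rank u.1) (enum_rank u.2) =
  #|[set z | ((u.1, z) \in S) && ((z, u.2) \in T)]|%:R.
Proof.
rewrite mxE -sum1_card natr_sum [RHS]big_mkcond /=.
rewrite (reindex (@enum_rank X)) /=; last exact/onW_bij/enum_rank_bij.
apply: eq_bigr => z _.
by rewrite !mxE !enum_rankK -natrM mulnb inE; case: (_ && _).
Qed.

Variable p : I -> I -> I -> nat -> nat -> nat -> R[i].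
Hypothesis pP : intersection_numbers C nu p.

(** The matrices of distinct relations have disjoint supports, so the entry at
    [u] of the product isolates one coefficient of its expansion. *)
Lemma intersection_number_card (i j h : I) (l m n : nat) (u : X * X) :
  i \in Omega C -> j \in Omega C -> h \in Omega C ->
  (eps i j <= l <= rnum C i j)%N -> (eps j h <= m <= rnum C j h)%N ->
  (eps i h <= n <= rnum C i h)%N -> u \in C (nu i h n) ->
  p i j h l m n =
    #|[set z | ((u.1, z) \in C (nu i j l)) && ((z, u.2) \in C (nu j h m))]|%:R.
Proof.
case: u => x y iO jO hO lr mr nr un; rewrite -relmx_mulE.
move: (pP iO jO hO lr mr); rewrite /adjmx => ->.
rewrite summxE (bigD1_seq n) ?mem_index_iota ?ltnS ?iota_uniq //=.
rewrite !mxE !enum_rankK un mulr1 big_nat_cond big1 ?addr0 // => k.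
case/andP; rewrite ltnS => kr kn.
rewrite !mxE !enum_rankK; have [uk|] := boolP (_ \in _); last by rewrite mulr0.
by case/eqP: kn; apply: nu_inj kr nr _ => //; apply: ccrel_meet uk un.
Qed.

(** The numbers [p] are given by matrix identities over [R[i]]; counting shows
    that they are real. *)
Lemma intersection_number_nat (i j h : I) (l m n : nat) :
  i \in Omega C -> j \in Omega C -> h \in Omega C ->
  (eps i j <= l <= rnum C i j)%N -> (eps j h <= m <= rnum C j h)%N ->
  (eps i h <= n <= rnum C i h)%N ->
  exists k : nat, p i j h l m n = k%:R.
Proof.
move=> iO jO hO lr mr nr; have [u un] := ccrel_inhabited (nu i h n).
by eexists; apply: intersection_number_card un.
Qed.

(** A path [x - z - y] counted by one of the two numbers becomes, once its
    first edge is reversed, a path [z - x - y] counted by the other. *)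
Lemma intersection_number_eq0C (i j : I) (l m n : nat) :
  symmetric_fibers C -> i \in Omega C -> j \in Omega C ->
  (eps i i <= l <= rnum C i i)%N -> (eps i j <= m <= rnum C i j)%N ->
  (eps i j <= n <= rnum C i j)%N ->
  p i i j l m n = 0 -> p i i j l n m = 0.
Proof.
move=> Csym iO jO lr mr nr p0; have [[x y] xym] := ccrel_inhabited (nu i j m).
rewrite (intersection_number_card _ _ _ _ _ _ xym) //=.
apply/eqP; rewrite pnatr_eq0 cards_eq0; apply/set0Pn => -[z].
rewrite inE => /andP[xz zy].
move/eqP: p0; rewrite (intersection_number_card _ _ _ _ _ _ zy) //=.
rewrite pnatr_eq0 cards_eq0 => /eqP/setP/(_ x); rewrite !inE xym andbT.
by rewrite -(Csym i iO) ?nu_block // inE /= xz.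
Qed.

(** * Eigenvalues *)

Variables (E : I -> I -> nat -> 'M[R[i]]_#|X|) (P : I -> I -> nat -> nat -> R[i]).
Hypothesis EP : block_bases C E.
Hypothesis PP : eigenvalues C nu E P.

Definition basis_tuple (i j : I) : (rtilde C i j).+1.-tuple 'M[R[i]]_#|X| :=
  [tuple of [seq E i j h | h <- iota_tuple (rtilde C i j).+1 0]].

Lemma basis_tupleE (i j : I) (h : 'I_(rtilde C i j).+1) :
  (basis_tuple i j)`_h = E i j h.
Proof. by rewrite (nth_map 0%N) ?size_iota // nth_iota. Qed.

Lemma basis_tupleP (i j : I) : i \in Omega C -> j \in Omega C ->
  basis_of (block_space C R i j) (basis_tuple i j).
Proof. by have [_ + _ _] := EP; apply. Qed.

Lemma basis_mx_neq0 (i j : I) (h : nat) : i \in Omega C -> j \in Omega C ->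
  (h <= rtilde C i j)%N -> E i j h != 0.
Proof.
move=> iO jO hr; have /basis_free/free_not0 f0 := basis_tupleP iO jO.
apply: f0; rewrite -[h]/(val (Ordinal (hr : (h < (rtilde C i j).+1)%N))).
by rewrite -basis_tupleE mem_nth // size_tuple.
Qed.

Lemma basis_mx_block_space (i j : I) (h : nat) :
  i \in Omega C -> j \in Omega C -> (h <= rtilde C i j)%N ->
  E i j h \in block_space C R i j.
Proof.
move=> iO jO hr; apply: (basis_mem (basis_tupleP iO jO)).
rewrite -[h]/(val (Ordinal (hr : (h < (rtilde C i j).+1)%N))).
by rewrite -basis_tupleE mem_nth // size_tuple.
Qed.

Lemma coord_eigenvalue (i j : I) (l : nat) (h : 'I_(rtilde C i j).+1) :
  i \in Omega C -> j \in Omega C -> (eps i j <= l <= rnum C i j)%N ->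
  coord (basis_tuple i j) h (adjmx C R nu i j l) = P i j l h.
Proof.
move=> iO jO lr; have /basis_free fr := basis_tupleP iO jO.
rewrite (PP iO jO lr) big_mkord linear_sum (bigD1 h) //= big1 => [|k kh].
  by rewrite addr0 linearZ /= -basis_tupleE coord_free // eqxx mulr1.
by rewrite linearZ /= -basis_tupleE coord_free // (negPf kh) mulr0.
Qed.

(** The adjacency matrices span the block.  If two columns of eigenvalues were
    proportional, then the corresponding two coordinates of every matrix in
    the block would be proportional, which fails for [E i j h]. *)
Lemma eigenvalue_columns_nonprop (i j : I) (h k : nat) (c : R[i]) :
  i \in Omega C -> j \in Omega C ->
  (h <= rtilde C i j)%N -> (k <= rtilde C i j)%N -> h != k ->
  ~ (forall l, (eps i j <= l <= rnum C i j)%N -> P i j l h = c * P i j l k).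
Proof.
move=> iO jO hr kr hk Phk; have /basis_free fr := basis_tupleP iO jO.
set h' := Ordinal (hr : (h < (rtilde C i j).+1)%N).
set k' := Ordinal (kr : (k < (rtilde C i j).+1)%N).
pose f : 'M[R[i]]_#|X| -> R[i]^o := fun M =>
  coord (basis_tuple i j) h' M - c * coord (basis_tuple i j) k' M.
have f_lin : linear f.
  move=> a u v; rewrite /f !linearP /= !mulrDr.
  rewrite opprD addrACA; congr (_ + _).
  by rewrite scalerBr /= /GRing.scale /= !mulrA (mulrC c a).
pose fl : {linear 'M[R[i]]_#|X| -> R[i]^o} :=
  HB.pack f (GRing.isLinear.Build _ _ _ _ f f_lin).
have : fl (E i j h) = 0.
  apply: (linear_span_eq0 _ (basis_mx_block_space iO jO hr)) => M /mapP[a].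
  rewrite mem_enum => /(block_nu iO jO)[l lr ->] ->.
  by rewrite /= /f !coord_eigenvalue // /= Phk // subrr.
rewrite /= /f -[h]/(val h') -basis_tupleE !coord_free // eqxx.
rewrite -val_eqE /= (negPf hk) mulr0 subr0 => /eqP.
by rewrite oner_eq0.
Qed.

(** For a [P]-polynomial ordering, every normalized eigenvalue at [h] is a
    function of the single value [Pbar P i j (1 + eps i j) h], so that equal
    values would give proportional columns. *)
Lemma Pbar_inj (i j : I) (h k : nat) : P_polynomial_witness C P ->
  i \in Omega C -> j \in Omega C ->
  (h <= rtilde C i j)%N -> (k <= rtilde C i j)%N ->
  Pbar P i j (1 + eps i j) h = Pbar P i j (1 + eps i j) k -> h = k.
Proof.
move=> Ppoly iO jO hr kr e; apply/eqP; apply/negPn/negP => hk.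
have [Pn0 [v vP]] := Ppoly i j iO jO.
apply: (@eigenvalue_columns_nonprop i j h k
          (P i j (eps i j) h / P i j (eps i j) k)) => // l lr.
have [_ vl] := vP l lr.
have : Pbar P i j l h = Pbar P i j l k by rewrite !vl // e.
rewrite /Pbar => /(congr1 (fun z => z * P i j (eps i j) h)).
rewrite divfK ?Pn0 // => ->.
by rewrite mulrAC [RHS]mulrAC [P i j l k * _]mulrC.
Qed.

(** The matrix [adjmx C R nu i i 0] is the identity on the fiber of [i], and the
    nonzero rows of a member of the block are indexed by its points. *)
Lemma adjmx0_mul_block (i j : I) (M : 'M[R[i]]_#|X|) : i \in Omega C ->
  M \in block_space C R i j -> adjmx C R nu i i 0 *m M = M.
Proof.
move=> iO Mb; set A := adjmx _ _ _ _ _ _.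
apply/eqP; rewrite -subr_eq0 -{2}[M]mul1mx -mulmxBl; apply/eqP.
apply: (@linear_span_eq0 _ _ _ (mulmx (A - 1%:M)) _ _ M Mb) => _ /mapP[a + ->].
rewrite mem_enum inE => /subsetP ab.
rewrite /= mulmxBl mul1mx; apply/eqP; rewrite subr_eq0; apply/eqP.
apply/matrixP => x y; rewrite mxE (bigD1 x) //= big1 => [|z zx]; last first.
  have [_ nu0 _] := nuP; rewrite !mxE nu0 // !inE /=.
  by rewrite (inj_eq enum_val_inj) eq_sym (negPf zx) andbF mul0r.
have [_ nu0 _] := nuP; rewrite addr0 !mxE nu0 // !inE /= eqxx andbT.
have [/ab|_] := boolP ((enum_val x, enum_val y) \in C a); last by rewrite mulr0.
by rewrite !inE /= => /andP[->]; rewrite mulr1.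
Qed.

(** The identity of the fiber fixes the idempotent [E i i h], while its
    expansion multiplies it by [P i i 0 h]. *)
Lemma eigenvalue0 (i : I) (h : nat) : i \in Omega C ->
  (h <= rtilde C i i)%N -> P i i 0 h = 1.
Proof.
move=> iO hr; have [_ _ _ EE] := EP.
have := adjmx0_mul_block iO (basis_mx_block_space iO iO hr).
rewrite PP // /eps ?eqxx // mulmx_suml big_mkord.
rewrite (bigD1 (Ordinal (hr : (h < (rtilde C i i).+1)%N))) //= big1; last first.
  move=> k; rewrite -val_eqE /= => kh.
  by rewrite -scalemxAl EE ?leq_ord // eqxx (negPf kh) scale0r scaler0.
rewrite addr0 -scalemxAl EE // !eqxx scale1r => /eqP.
rewrite -subr_eq0 -{2}[E i i h]scale1r -scalerBl scaler_eq0 subr_eq0.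
by rewrite (negPf (basis_mx_neq0 iO iO hr)) orbF => /eqP.
Qed.

(** The identity of the fiber is a combination of the idempotents of its
    scheme.  Those annihilate every [E i j h] whose index exceeds
    [rtilde C i i], while the identity fixes it. *)
Lemma rtilde_le (i j : I) : i \in Omega C -> j \in Omega C ->
  (rtilde C i j <= rtilde C i i)%N.
Proof.
move=> iO jO; have [_ _ _ EE] := EP; rewrite leqNgt; apply/negP => lt.
have := adjmx0_mul_block iO (basis_mx_block_space iO jO (leqnn _)).
rewrite PP // /eps ?eqxx // mulmx_suml big_nat_cond big1 => [/esym/eqP|k].
  exact/negP/basis_mx_neq0.
rewrite andbT ltnS => /andP[_ kr].
rewrite -scalemxAl EE // eqxx.
by rewrite (ltn_eqF (leq_ltn_trans kr lt)) scale0r scaler0.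
Qed.

Lemma adjmx_mul_basis_mx (i j : I) (l h : nat) :
  i \in Omega C -> j \in Omega C -> (eps i i <= l <= rnum C i i)%N ->
  (h <= rtilde C i j)%N ->
  adjmx C R nu i i l *m E i j h = P i i l h *: E i j h.
Proof.
move=> iO jO lr hr; have [_ _ _ EE] := EP.
have hr' := leq_trans hr (rtilde_le iO jO).
rewrite PP // mulmx_suml big_mkord.
rewrite (bigD1 (Ordinal (hr' : (h < (rtilde C i i).+1)%N))) //= big1; last first.
  move=> k; rewrite -val_eqE /= => kh.
  by rewrite -scalemxAl EE ?leq_ord // eqxx (negPf kh) scale0r scaler0.
by rewrite addr0 -scalemxAl EE // !eqxx scale1r.
Qed.

(** The two sides are the coordinates on [E i j h] of the product of
    [adjmx C R nu i i l] and [adjmx C R nu i j m], computed with eigenvalues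
    and with intersection numbers. *)
Lemma eigenvalue_mul (i j : I) (l m h : nat) :
  i \in Omega C -> j \in Omega C -> (eps i i <= l <= rnum C i i)%N ->
  (eps i j <= m <= rnum C i j)%N -> (h <= rtilde C i j)%N ->
  P i i l h * P i j m h =
    \sum_(eps i j <= n < (rnum C i j).+1) p i i j l m n * P i j n h.
Proof.
move=> iO jO lr mr hr; have /basis_free fr := basis_tupleP iO jO.
set h' := Ordinal (hr : (h < (rtilde C i j).+1)%N).
have := congr1 (coord (basis_tuple i j) h') (pP iO iO jO lr mr).
rewrite [X in _ *m X]PP // mulmx_sumr big_mkord !linear_sum (bigD1 h') //=.
rewrite big1 => [|k kh]; last first.
  rewrite -scalemxAr adjmx_mul_basis_mx ?leq_ord // scalerA linearZ /=.
  by rewrite -basis_tupleE coord_free // (negPf kh) mulr0.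
rewrite -scalemxAr adjmx_mul_basis_mx // scalerA linearZ /=.
rewrite -[X in E i j X]/(val h') -basis_tupleE coord_free // eqxx mulr1.
rewrite addr0 mulrC => ->.
rewrite big_nat_cond [RHS]big_nat_cond; apply: eq_bigr => n.
rewrite ltnS andbT => nr.
by rewrite linearZ /= coord_eigenvalue.
Qed.

End Configuration.

(** * The equivalence *)

Theorem proposition4p1 (R : realType) (X I : finType)
    (C : coherent_configuration X I)
    (nu : I -> I -> nat -> I)
    (E : I -> I -> nat -> 'M[R[i]]_#|X|)
    (p : I -> I -> I -> nat -> nat -> nat -> R[i])
    (P : I -> I -> nat -> nat -> R[i])
    (Csym : symmetric_fibers C)
    (nuP : block_numbering C nu)
    (EP : block_bases C E)
    (pP : intersection_numbers C nu p)
    (PP : eigenvalues C nu E P)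
    (Ppoly : P_polynomial_witness C P)
    (i j : I) (iO : i \in Omega C) (jO : j \in Omega C)
    (ij : i != j) (rij : (1 <= rtilde C i j)%N) :
  let affine_relation (alpha beta : R) : Prop :=
    alpha != 0 /\
    forall h : nat, (h <= rtilde C i j)%N ->
      Pbar P i i 1 h = alpha%:C * Pbar P i j 2 h + beta%:C in
  ((exists alpha beta : R, affine_relation alpha beta) <->
   tridiagonal (cross_mx C p i j)) /\
  (forall alpha beta : R, affine_relation alpha beta ->
     alpha%:C = p i i j 1%N 1%N 2%N /\ beta%:C = p i i j 1%N 1%N 1%N).
Proof.
move=> affine.
have eii : eps i i = 0%N by rewrite /eps eqxx.
have eij : eps i j = 1%N by rewrite /eps ij.
set d := rtilde C i j in rij *.
have rE : rnum C i j = d.+1.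
  by move: rij; rewrite /d /rtilde eij subn1; case: (rnum C i j).
have dii : (d <= rtilde C i i)%N by apply: rtilde_le nuP _ _ EP PP _ _ iO jO.
have r1 : (eps i i <= 1 <= rnum C i i)%N.
  rewrite eii; apply: leq_trans rij (leq_trans dii _).
  by rewrite /rtilde leq_subr.
have rangeP n : (n <= d)%N -> (eps i j <= n.+1 <= rnum C i j)%N.
  by rewrite eij rE.
pose x h := Pbar P i i 1 h.
pose y h := Pbar P i j 2 h.
pose M l n := p i i j 1%N l.+1 n.+1.
have [Pn0 [v vP]] := Ppoly i j iO jO.
have Pbar1 h : (h <= d)%N -> Pbar P i j 1 h = 1.
  by move=> hd; move: (Pn0 h hd); rewrite /Pbar eij => /divff.
have rec l h : (l <= d)%N -> (h <= d)%N ->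
    x h * Pbar P i j l.+1 h = \sum_(0 <= n < d.+1) M l n * Pbar P i j n.+1 h.
  move=> ld hd; rewrite /x /Pbar eii (eigenvalue0 nuP EP PP) ?divr1 //; last first.
    exact: leq_trans hd dii.
  rewrite mulrA (eigenvalue_mul nuP pP EP PP) ?rangeP // eij rE big_add1 /=.
  by rewrite mulr_suml; apply: eq_bigr => n _; rewrite mulrA.
have yinj : {in gtn d.+1 &, injective y}.
  move=> h k; rewrite !unfold_in /= !ltnS => hd kd.
  have := Pbar_inj nuP EP PP Ppoly iO jO hd kd.
  by rewrite eij.
have xinj h k : (h <= d)%N -> (k <= d)%N -> x h = x k -> h = k.
  move=> hd kd; have := Pbar_inj nuP EP PP Ppoly iO iO
    (leq_trans hd dii) (leq_trans kd dii).
  by rewrite eii.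
have lowM l n : (l <= d)%N -> (n <= d)%N -> M l n = 0 -> M n l = 0.
  by move=> ld nd; apply: (intersection_number_eq0C nuP pP) => //; apply: rangeP.
have triE : tridiagonal (cross_mx C p i j) <->
    (forall l n, (l.+1 < n <= d)%N -> M l n = 0).
  split=> [tri l n /andP[ln nd]|tri l n].
    have ld : (l <= d)%N by apply: leq_trans nd; do 2!apply: ltnW.
    have := tri (Ordinal (ld : (l < d.+1)%N)) (Ordinal (nd : (n < d.+1)%N)).
    by rewrite mxE /= eij !addn1 ln; apply.
  rewrite mxE eij !addn1 => /orP[ln|nl].
    by apply: tri; rewrite ln leq_ord.
  by apply: lowM; rewrite ?leq_ord // tri // nl leq_ord.
(* In row [0] the factor [Pbar P i j 1 h] is [1], and tridiagonality leaves
   only the columns [0] and [1]. *)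
have row0 : (forall l n, (l.+1 < n <= d)%N -> M l n = 0) ->
    forall h, (h <= d)%N -> x h = M 0%N 1%N * y h + M 0%N 0%N.
  move=> tri h hd; have := rec 0%N h (leq0n _) hd; rewrite Pbar1 // mulr1 => ->.
  rewrite big_nat_recl // Pbar1 // mulr1 addrC; congr (_ + _).
  rewrite -{1}(ltn_predK rij) big_nat_recl // big_nat_cond big1 ?addr0 // => n.
  rewrite andbT => /andP[_ nd]; rewrite tri ?mul0r //=.
  by rewrite -(ltn_predK rij).
have affine_tri a b : affine a b ->
    forall l n, (l.+1 < n <= d)%N -> M l n = 0.
  case=> _ xE; apply: (@graded_recurrence_upper _ d (fun n => v n.+1) _ x y
    a%:C b%:C) => //.
    by move=> n /rangeP/vP[-> _]; rewrite eij subn1.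
  move=> l h ld hd; have vE n : (n <= d)%N -> (v n.+1).[y h] = Pbar P i j n.+1 h.
    by move=> /rangeP/vP[_ ->] //; rewrite eij.
  rewrite vE // rec // big_nat_cond [RHS]big_nat_cond.
  by apply: eq_bigr => n; rewrite andbT ltnS => nd; rewrite vE.
have y01 : y 1%N - y 0%N != 0.
  by rewrite subr_eq0; apply/eqP => /yinj; rewrite !unfold_in /= ltnS => /(_ rij isT).
split; last first.
  move=> a b ab; have [_ xE] := ab.
  have ME := row0 (affine_tri a b ab).
  have e0 := ME 0%N (leq0n d); have e1 := ME 1%N rij.
  move: (xE 0%N (leq0n d)) (xE 1%N rij); rewrite -/(x _) -/(x _) -/(y _) -/(y _).
  rewrite e0 e1 => f0 f1.
  have aE : a%:C = M 0%N 1%N.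
    apply: (mulIf y01); rewrite !mulrBr.
    apply: (addIr (a%:C * y 0%N + b%:C)).
    by rewrite addrA subrK -f1 -{1}f0 addrA subrK.
  split=> //; move: f0; rewrite aE => /addrI <-; exact: erefl.
split=> [[a [b ab]]|]; first exact/triE/affine_tri/ab.
move=> /triE tri; have ME := row0 tri.
have [ka kaE] : exists k : nat, M 0%N 1%N = k%:R.
  by apply: (intersection_number_nat nuP pP) => //; apply: rangeP.
have [kb kbE] : exists k : nat, M 0%N 0%N = k%:R.
  by apply: (intersection_number_nat nuP pP) => //; apply: rangeP.
(* The constants must be real, which is why the intersection numbers are
   identified with naturals. *)
exists ka%:R, kb%:R; split=> [|h hd]; last first.
  by rewrite !rmorph_nat -kaE -kbE -/(x h) ME.
(* Otherwise [x] would be constant, although [d >= 1]. *)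
apply/eqP => ka0; have : x 0%N = x 1%N.
  rewrite !ME // kaE -(rmorph_nat (real_complex R)) ka0 rmorph0.
  by rewrite !mul0r.
by move/xinj => /(_ (leq0n _) rij).
Qed.
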